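(* Let $\pi=(\pi_1,\ldots,\pi_n)$ be an autotopy of $C\in\mathcal{P}^n(v,k,\lambda)$. Then every component $\pi_x$, $x\in\{1,\ldots,n\}$, has the same number of fixed points.
   Context: An incidence matrix of a symmetric $(v,k,\lambda)$ design is a $v\times v$ matrix $A$ with $\{0,1\}$-entries satisfying $AA^t=(k-\lambda)I+\lambda J$, where $I$ is the identity matrix and $J$ the all-ones matrix; parameters are assumed nondegenerate, $0\le\lambda<k$. For $n\ge 2$, $\mathcal{P}^n(v,k,\lambda)$ is the set of all functions $C:\{1,\ldots,v\}^n\to\{0,1\}$ such that for all $1\le x<y\le n$ the $2$-projection $\Pi_{xy}(C)$ is an incidence matrix of a symmetric $(v,k,\lambda)$ design; here $\Pi_{xy}(C)$ is the $v\times v$ matrix whose $(i_x,i_y)$-entry is the sum (in characteristic $0$) of $C(i_1,\ldots,i_n)$ over all $n$-tuples in $\{1,\ldots,v\}^n$ with the given coordinates $i_x,i_y$. An autotopy of $C$ is an $n$-tuple $(\pi_1,\ldots,\pi_n)\in (S_v)^n$ such that $C(i_1,\ldots,i_n)=C(\pi_1^{-1}(i_1),\ldots,\pi_n^{-1}(i_n))$ for all $i_1,\ldots,i_n\in\{1,\ldots,v\}$. *)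

(* Defs.v *)
From mathcomp Require Import all_boot all_order all_algebra all_fingroup.

Set Implicit Arguments.
Unset Strict Implicit.
Unset Printing Implicit Defensive.

Import GRing.Theory.
Local Open Scope ring_scope.

Definition incidence_matrix (v k l : nat) (A : 'M[int]_v) : Prop :=
  (forall i j, A i j = 0 \/ A i j = 1) /\
  A *m A^T = (k%:Z - l%:Z)%:M + const_mx l%:Z.

(* The index set {1, ..., v}^n is {ffun 'I_n -> 'I_v}; {0,1}-valued functions
   on it are bool-valued, and the sum is taken in int. *)
Definition projection (n v : nat) (C : {ffun 'I_n -> 'I_v} -> bool)
    (x y : 'I_n) : 'M[int]_v :=
  \matrix_(i, j)
    \sum_(f : {ffun 'I_n -> 'I_v} | (f x == i) && (f y == j)) (C f)%:R.

Definition projection_cube (n v k l : nat)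
    (C : {ffun 'I_n -> 'I_v} -> bool) : Prop :=
  forall x y : 'I_n, (x < y)%N -> incidence_matrix k l (projection C x y).

Definition autotopy (n v : nat) (C : {ffun 'I_n -> 'I_v} -> bool)
    (p : {ffun 'I_n -> 'S_v}) : Prop :=
  forall f : {ffun 'I_n -> 'I_v}, C f = C [ffun x => ((p x)^-1)%g (f x)].

Definition fixed_points (v : nat) (s : 'S_v) : {set 'I_v} :=
  [set i | s i == i].

(* Main.v *)
Require Import Defs.
From mathcomp Require Import all_boot all_order all_algebra all_fingroup.
From mathcomp Require Import ring.

(**
Permuting the coordinates of $C$ by the autotopy fixes the projection
$A = \Pi_{xy}(C)$, so the permutation matrices of $\pi_x$ and $\pi_y$ are
intertwined by $A$. As $A A^t = (k-\lambda)I + \lambda J$ is nonsingular, so is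
$A$; hence the two permutation matrices are similar, and their traces, which
count fixed points, agree.
*)

Set Implicit Arguments.
Unset Strict Implicit.
Unset Printing Implicit Defensive.

Import Order.TTheory GRing.Theory Num.Theory.
Local Open Scope ring_scope.

Lemma mxtrace_perm_mx (R : pzSemiRingType) (v : nat) (s : 'S_v) :
  \tr (perm_mx s : 'M[R]_v) = #|fixed_points s|%:R.
Proof.
rewrite /mxtrace -sum1_card natr_sum [RHS]big_mkcond /=.
by apply: eq_bigr => i _; rewrite !mxE inE; case: eqP.
Qed.

(** Over a domain such as [int], [A] may lack an inverse, so the adjugate stands in:
    [\det A * \tr P] is the trace of [P A (\adj A) = A Q (\adj A)], which by cyclicity is that of
    [Q (\adj A) A]. Then [\det A] cancels. *)
Lemma mxtrace_intertwined (R : idomainType) (v : nat) (P Q A : 'M[R]_v) :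
  \det A != 0 -> P *m A = A *m Q -> \tr P = \tr Q.
Proof.
move=> dA0 PA; apply: (mulfI dA0).
rewrite -!mxtraceZ -(mul_mx_scalar _ P) -(mul_mx_scalar _ Q).
by rewrite -{1}mul_mx_adj mulmxA PA -mulmxA mxtrace_mulC -mulmxA mul_adj_mx.
Qed.

Lemma mulmx_const (R : pzSemiRingType) (m n p : nat) (a b : R) :
  (const_mx a : 'M_(m, n)) *m (const_mx b : 'M_(n, p)) =
  const_mx (a * b *+ n).
Proof.
apply/matrixP=> i j; rewrite !mxE.
by under eq_bigr do rewrite !mxE; rewrite sumr_const card_ord.
Qed.

(* [(d + l v) I - l J] is a scalar multiple of the inverse of [d I + l J]. *)
Lemma mulmx_scalar_add_const (R : comPzRingType) (v : nat) (d l : R) :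
  (d%:M + const_mx l) *m ((d + l *+ v)%:M - const_mx l) =
  (d * (d + l *+ v))%:M :> 'M_v.
Proof.
rewrite mulmxBr !mulmxDl mulmx_const -scalar_mxM mul_mx_scalar mul_scalar_mx.
rewrite -addrA; apply/matrixP=> i j; rewrite !mxE -(mulr_natr l v).
rewrite -(mulr_natr (l * l)); ring.
Qed.

(** With [d = k - l], determinants in the product identity make [\det A] a divisor of
    [(d * (d + l v)) ^ v], nonzero as [d > 0] and [l >= 0]. *)
Lemma det_incidence_matrix_neq0 (v k l : nat) (A : 'M[int]_v) :
  (l < k)%N -> incidence_matrix k l A -> \det A != 0.
Proof.
move=> ltlk [_ AAt].
have d_gt0 : 0 < k%:Z - l%:Z by rewrite subr_gt0 ltz_nat.
have /(congr1 determinant) := mulmx_scalar_add_const v (k%:Z - l%:Z) l%:Z.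
rewrite -AAt !det_mulmx det_scalar => detE.
apply/eqP => dA0; move/eqP: detE.
rewrite dA0 !mul0r eq_sym expf_eq0 mulf_eq0.
by rewrite !gt_eqF ?andbF // ltr_wpDr ?mulrn_wge0.
Qed.

Lemma perm_mx_projection (n v : nat) (C : {ffun 'I_n -> 'I_v} -> bool)
    (p : {ffun 'I_n -> 'S_v}) (x y : 'I_n) :
  autotopy C p ->
  perm_mx (p x) *m projection C x y = projection C x y *m perm_mx (p y).
Proof.
(* [col_permE] multiplies by the matrix of an inverse, hence the double inverse of [p y]. *)
move=> Cp; rewrite -row_permE -[p y]invgK -col_permE.
apply/matrixP=> i j; rewrite !mxE.
pose act (q : 'I_n -> 'S_v) (f : {ffun 'I_n -> 'I_v}) := [ffun z => q z (f z)].
have actK : cancel (act (fun z => (p z)^-1%g)) (act p).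
  by move=> f; apply/ffunP=> z; rewrite !ffunE permKV.
have actVK : cancel (act p) (act (fun z => (p z)^-1%g)).
  by move=> f; apply/ffunP=> z; rewrite !ffunE permK.
(* Substituting [act p f] for [f] turns the conditions [f x = p x i], [f y = j] into [f x = i],
   [f y = (p y)^-1 j]; the autotopy keeps the value of [C]. *)
rewrite (reindex_inj (can_inj actVK)); apply: eq_big => f.
  by rewrite !ffunE (inj_eq perm_inj) -{1}(permKV (p y) j) (inj_eq perm_inj).
by move=> _; rewrite Cp -/(act (fun z => (p z)^-1%g) _) actVK.
Qed.

Theorem proposition3p3 (n v k l : nat) (hn : (2 <= n)%N) (hlk : (l < k)%N)
    (C : {ffun 'I_n -> 'I_v} -> bool) (hC : projection_cube k l C)
    (p : {ffun 'I_n -> 'S_v}) (hp : autotopy C p) :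
  forall x y : 'I_n, #|fixed_points (p x)| = #|fixed_points (p y)|.
Proof.
move=> x y; wlog ltxy : x y / (x < y)%N => [wlt|].
  by case: (ltngtP x y) => [/wlt|/wlt|/val_inj->].
(* Traces recover the counts because [int] has characteristic 0. *)
apply/eqP; rewrite -(eqr_nat int) -!mxtrace_perm_mx; apply/eqP.
apply: mxtrace_intertwined (perm_mx_projection x y hp).
exact: det_incidence_matrix_neq0 hlk (hC _ _ ltxy).
Qed.
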